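(* Consider the system $$\dot x_1=f_1(t,x_1)+a(t,x_1)\mathsf B(t,x_1)x_2,\qquad\dot x_2=f_2(t,x_1,x_2),\qquad(x_1,x_2)\in\mathbb R^{n_1}\times\mathbb R^{n_2},$$ with output $y=x_1$, where $f_1:\mathbb R_{\ge0}\times\mathbb R^{n_1}\to\mathbb R^{n_1}$ and $f_2:\mathbb R_{\ge0}\times\mathbb R^{n_1}\times\mathbb R^{n_2}\to\mathbb R^{n_2}$ are $C^0$ and locally Lipschitz in $x_1$ and $(x_1,x_2)$, respectively, $a\in C^1(\mathbb R_{\ge0}\times\mathbb R^{n_1};\mathbb R)$ and $\mathsf B\in C^1(\mathbb R_{\ge0}\times\mathbb R^{n_1};\mathbb R^{n_1\times n_2})$. Let $M\subset\mathbb R^{n_1}\times\mathbb R^{n_2}$ be nonempty and closed with $0\in M$ and assume the system is $M$-forward complete, with bound $\beta\in NNN$. Assume: (1) There exist an integer $\ell\in\mathbb N$ and a map $\mathsf D\in C^0(\mathbb R_{\ge0}\times\mathbb R^\ell\times\mathbb R^{n_1};\mathbb R^{n_2\times n_2})$ such that for every $R>0$, $t_0\ge0$ and $\xi>0$ there exists a set-valued map $[t_0,\infty)\ni t\mapsto Q_R(t)=Q_{R,t_0,\xi}(t)\subset\mathbb R^\ell$ satisfying the CP such that for every $t\ge t_0$, every $y\in Y_R(t):=\{y\in\mathbb R^{n_1}:y=x_1\text{ for some }x=(x_1,x_2)\text{ with }|x|\le\beta(t,t_0,R)\}$ and all $x_2,z_2\in\mathbb R^{n_2}$ with $|x_2|\le\beta(t,t_0,R)$,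 $|x_2-z_2|\le\xi$, there is $q\in Q_R(t)$ with $f_2(t,y,x_2)-f_2(t,y,z_2)=\mathsf D(t,q,y)(x_2-z_2)$. (2) There exists a constant $L>1$ such that for every $R>0$ there exists $\varepsilon_R>0$ such that for every $\bar t_0\ge t_0\ge0$, $\xi>0$ and $y=y(\cdot,t_0,x_0)\in Y(\mathbb R_{\ge0},M)\cap C^0([t_0,\infty);\mathbb R^{n_1})$ there exist a time-varying symmetric matrix $P_R=P_{R,t_0,\bar t_0,\xi,y}\in C^1([\bar t_0,\infty);\mathbb R^{n_2\times n_2})$ and a function $d_R=d_{R,t_0,\bar t_0,\xi,y}\in C^0([\bar t_0,\infty);\mathbb R)$ with $$P_R(t)\ge I\ \ \forall t\ge\bar t_0,\qquad|P_R(\bar t_0)|\le L,$$ $$\int_{\bar t_0}^td_R(s)\,ds>-\varepsilon_R\ \ \forall t\ge\bar t_0,\qquad\int_{\bar t_0}^\infty d_R(s)\,ds=\infty,$$ and, provided that $y\in Y(\mathbb R_{\ge0},B_R\cap M)\cap C^0([t_0,\infty);\mathbb R^{n_1})$, $$e'P_R(t)\mathsf D(t,q,y(t))e+\tfrac12e'\dot P_R(t)e\le-d_R(t)e'P_R(t)e\quad\forall t\ge\bar t_0,\ e\in\ker\mathsf B(t,y(t)),\ q\in Q_R(t),$$ where $Q_R=Q_{R,t_0,\xi}$ and $\mathsf D$ are those of (1); in addition, for each fixed $R,t_0,\bar t_0,\xi$ the mappings $[\bar t_0,\infty)\times M\ni(t,x_0)\mapsto P_{R,t_0,\bar t_0,\xi,y(\cdot,t_0,x_0)}(t),\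 d_{R,t_0,\bar t_0,\xi,y(\cdot,t_0,x_0)}(t)$ are continuous and causal with respect to $Y(\mathbb R_{\ge0},M)$. (3) For every $t_0\ge0$ and $x_0\in M$ it holds $a(t,x_1(t,t_0,x_0))\ne0$ for all $t\ge t_0$. Then the S-SODP is solvable for the system with respect to $Y(\mathbb R_{\ge0},M)$.
   Context: Notation: $|x|$ is the Euclidean norm, $|A|=\max\{|Ax|:|x|=1\}$ the induced matrix norm, $A'$ the transpose, $B_R$ the closed ball of radius $R$ centered at $0$ in the state space $\mathbb R^n$, $n=n_1+n_2$; matrix inequalities are in the sense of quadratic forms. $N$ is the class of increasing continuous functions $\mathbb R_{\ge0}\to\mathbb R_{\ge0}$; $NNN$ is the class of continuous functions $\beta:(\mathbb R_{\ge0})^3\to\mathbb R_{\ge0}$ that belong to $N$ with respect to each of their three arguments. CP (Compactness Property): a set-valued map $[t_0,\infty)\ni t\mapsto Q(t)\subset\mathbb R^\ell$ satisfies the CP if for every sequence $t_\nu\to t$ in $[t_0,\infty)$ and $q_\nu\in Q(t_\nu)$ there are a subsequence $(q_{\nu_k})$ and $q\in Q(t)$ with $q_{\nu_k}\to q$. Forward completeness and outputs: $x(\cdot,t_0,x_0)=(x_1(\cdot,t_0,x_0),x_2(\cdot,t_0,x_0))$ is the solution with $x(t_0)=x_0$. The system is $M$-forward complete if there is $\beta\in NNN$ with $|x(t,t_0,x_0)|\le\beta(t,t_0,|x_0|)$ for all $t\ge t_0\ge0$, $x_0\in M$; this $\beta$ is fixed. $y(t,t_0,x_0):=x_1(t,t_0,x_0)$,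 and for $I\subset\mathbb R_{\ge0}$, $Y(I,M)$ is the set of all outputs $y(\cdot,t_0,x_0):[t_0,\infty)\to\mathbb R^k$ (here $k=n_1$) with $(t_0,x_0)\in I\times M$. Causality: an object $a_{t_0,y}$ (a function of time $t$ in a subinterval of $[t_0,\infty)$ and possibly of further variables, possibly depending on further fixed parameters) assigned to each $y\in Y(\mathbb R_{\ge0},M)\cap C^0([t_0,\infty);\mathbb R^k)$ is causal with respect to $Y(\mathbb R_{\ge0},M)$ if its value at time $t$ depends only on the values $y(s)$, $t_0\le s\le t$, of $y$ (it is independent of the future values $y(s)$, $s>t$). When, for every $y$, existence of a causal object is asserted, the objects are understood as such a family indexed by $y$. S-SODP (Strong Switching Observer Design Problem): it is solvable for the system with respect to $Y(\mathbb R_{\ge0},M)$ if for every $t_0\ge0$ and $y\in Y(\mathbb R_{\ge0},M)\cap C^0([t_0,\infty);\mathbb R^k)$ there exist: a strictly increasing sequence of times $(t_m)_{m\in\mathbb N}$ with $t_1=t_0$ and $\lim_{m\to\infty}t_m=\infty$; a sequence of continuous mappings $g_m=g_{m,t_m,y}(t,z,w):[t_{m-1},t_{m+1}]\times\mathbb R^n\times\mathbb R^k\to\mathbb R^n$, $m\in\mathbb N$, which are causal with respect to $Y(\mathbb R_{\ge0},M)$; and a nonempty set $\bar M\subset\mathbb R^n$, such that any solution $z_m(\cdot)$ of $\dot z_m=g_m(t,z_m,y(t))$ with $z_m(t_{m-1})\in\bar M$ is defined for each $t\in[t_{m-1},t_{m+1}]$, $m\in\mathbb N$, and, with $Z(t):=z_m(t)$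 for $t\in[t_m,t_{m+1})$, $m\in\mathbb N$, one has $\lim_{t\to\infty}(x(t)-Z(t))=0$, where $x(\cdot)=x(\cdot,t_0,x_0)$, $x_0\in M$, is the trajectory of the system with output $y$. *)

(* Defs.v *)
From HB Require Import structures.
From mathcomp Require Export all_boot all_order all_algebra.
From mathcomp Require Export all_classical all_reals all_analysis.

Set Implicit Arguments.
Unset Strict Implicit.
Unset Printing Implicit Defensive.

Export Order.TTheory GRing.Theory Num.Theory.
Export numFieldNormedType.Exports.

Local Open Scope classical_set_scope.
Local Open Scope ring_scope.

(* The library norm on matrices is the sup norm: it provides the topology,
   while every quantitative bound below uses the Euclidean norm. *)
Definition enorm (R : realType) (n : nat) (v : 'cV[R]_n) : R :=
  Num.sqrt (\sum_i v i 0 ^+ 2).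

Definition opnorm (R : realType) (m n : nat) (A : 'M[R]_(m, n)) : R :=
  sup [set enorm (A *m v) | v in [set v | enorm v = 1]].

Definition qform (R : realType) (n : nat) (A : 'M[R]_n) (e : 'cV[R]_n) : R :=
  (e^T *m A *m e) 0 0.

Definition mxle (R : realType) (n : nat) (A B : 'M[R]_n) : Prop :=
  forall e, qform A e <= qform B e.

(* "Increasing" is read as nondecreasing; this is the larger class. *)
Definition class_N (R : realType) (f : R -> R) : Prop :=
  [/\ forall s, 0 <= s -> 0 <= f s,
      {within `[0, +oo[, continuous f} &
      {in `[0, +oo[ &, {homo f : s t / s <= t}}].

Definition class_NNN (R : realType) (b : R -> R -> R -> R) : Prop :=
  {within [set p : R * R * R | [/\ 0 <= p.1.1, 0 <= p.1.2 & 0 <= p.2]],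
     continuous (fun p => b p.1.1 p.1.2 p.2)} /\
  forall r s, 0 <= r -> 0 <= s ->
    [/\ class_N (fun t => b t r s), class_N (fun t => b r t s) &
        class_N (fun t => b r s t)].

(* The limit of the difference quotient along [A]; one-sided at an endpoint of
   an interval, and no constraint at an isolated point. *)
Definition is_derive_within (R : realType) (V : normedModType R)
    (A : set R) (f : R -> V) (t : R) (df : V) : Prop :=
  (fun s => (s - t)^-1 *: (f s - f t)) @ within A t^' --> df.

Definition C1_within (R : realType) (V : normedModType R)
    (A : set R) (f df : R -> V) : Prop :=
  (forall t, A t -> is_derive_within A f t (df t)) /\
  {within A, continuous df}.

Definition is_solution (R : realType) (n : nat) (F : R -> 'cV[R]_n -> 'cV[R]_n)
    (A : set R) (z : R -> 'cV[R]_n) : Prop :=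
  forall t, A t -> is_derive_within A z t (F t (z t)).

(* Functions of (t, x) with t >= 0. *)
Definition C0_halfspace (R : realType) (V W : normedModType R)
    (F : R -> V -> W) : Prop :=
  {within [set p : R * V | 0 <= p.1], continuous (fun p => F p.1 p.2)}.

Definition C1_halfspace (R : realType) (n : nat) (W : normedModType R)
    (F : R -> 'cV[R]_n -> W) : Prop :=
  C0_halfspace F /\
  exists (Ft : R -> 'cV[R]_n -> W) (Fx : 'I_n -> R -> 'cV[R]_n -> W),
    [/\ C0_halfspace Ft,
        forall j, C0_halfspace (Fx j),
        forall t x, 0 <= t ->
          is_derive_within `[0, +oo[ (fun s => F s x) t (Ft t x) &
        forall t x j, 0 <= t -> is_derive x (delta_mx j 0) (F t) (Fx j t x)].

(* Lipschitz in x near every point, with a constant locally uniform in t. *)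
Definition loc_lipschitz (R : realType) (V W : normedModType R)
    (F : R -> V -> W) : Prop :=
  forall t x, 0 <= t -> exists k e : R, 0 < e /\
    forall s, 0 <= s -> `|s - t| < e -> k.-lipschitz_(ball x e) (F s).

Definition compactness_property (R : realType) (l : nat) (t0 : R)
    (Q : R -> set 'cV[R]_l) : Prop :=
  forall (u : nat -> R) (t : R) (q : nat -> 'cV[R]_l),
    (forall i, t0 <= u i) -> t0 <= t -> u @ \oo --> t ->
    (forall i, Q (u i) (q i)) ->
    exists (h : nat -> nat) (p : 'cV[R]_l),
      [/\ forall i, (h i < h i.+1)%N, Q t p & (q \o h) @ \oo --> p].

(* Throughout, [x t t0 x0] is the value at time t of the solution which starts
   from x0 at time t0, meaningful for 0 <= t0 <= t and x0 in M. *)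
Definition forward_complete_with (R : realType) (n : nat)
    (F : R -> 'cV[R]_n -> 'cV[R]_n) (M : set 'cV[R]_n)
    (x : R -> R -> 'cV[R]_n -> 'cV[R]_n) (beta : R -> R -> R -> R) : Prop :=
  forall t0 x0, 0 <= t0 -> M x0 ->
    [/\ x t0 t0 x0 = x0,
        is_solution F `[t0, +oo[ (fun t => x t t0 x0) &
        forall t, t0 <= t -> enorm (x t t0 x0) <= beta t t0 (enorm x0)].

(* The outputs in Y(R>=0, M) with domain [t0, +oo[ that are continuous; a total
   function represents such an output through its values on [t0, +oo[. *)
Definition outputs (R : realType) (n k : nat) (out : 'cV[R]_n -> 'cV[R]_k)
    (x : R -> R -> 'cV[R]_n -> 'cV[R]_n) (t0 : R) (M : set 'cV[R]_n) :
    set (R -> 'cV[R]_k) :=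
  [set y | (exists2 x0, M x0 & forall t, t0 <= t -> y t = out (x t t0 x0)) /\
           {within `[t0, +oo[, continuous y}].

(* [a y] is a function of time with domain [dom y]; further variables may be
   hidden in the value type T. *)
Definition causal (R : realType) (k : nat) (T : Type) (t0 : R)
    (Y : set (R -> 'cV[R]_k)) (dom : (R -> 'cV[R]_k) -> set R)
    (a : (R -> 'cV[R]_k) -> R -> T) : Prop :=
  forall y y' t, Y y -> Y y' -> dom y t -> dom y' t ->
    (forall s, t0 <= s <= t -> y s = y' s) -> a y t = a y' t.

(* The strong switching observer design problem.  The times, dynamics and sets
   of initial states chosen for every y are given as families indexed by y.
   The initial time t0 is also the time of index 0, so that
   tau y 0 = tau y 1 = t0.  "Any solution starting in Mb is defined on
   [a, b]" says that any solution on a subinterval containing a extends to a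
   solution on [a, b]; the subinterval {a} yields existence. *)
Definition SSODP (R : realType) (n k : nat) (out : 'cV[R]_n -> 'cV[R]_k)
    (x : R -> R -> 'cV[R]_n -> 'cV[R]_n) (M : set 'cV[R]_n) : Prop :=
  forall t0, 0 <= t0 ->
  exists (tau : (R -> 'cV[R]_k) -> nat -> R)
         (g : (R -> 'cV[R]_k) -> nat -> R -> 'cV[R]_n -> 'cV[R]_k -> 'cV[R]_n)
         (Mb : (R -> 'cV[R]_k) -> set 'cV[R]_n),
  let Y := outputs out x t0 M in
  let J y m := `[tau y m.-1, tau y m.+1]%classic in
  let ode y m t z := g y m t z (y t) in
  (forall m, (0 < m)%N -> causal t0 Y (fun y => J y m) (fun y => g y m)) /\
  forall y, Y y ->
  [/\ [/\ tau y 0%N = t0, tau y 1%N = t0,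
          forall m, (0 < m)%N -> tau y m < tau y m.+1 &
          tau y @ \oo --> +oo],
      forall m, (0 < m)%N ->
        {within [set p : R * 'cV[R]_n * 'cV[R]_k | J y m p.1.1],
           continuous (fun p => g y m p.1.1 p.1.2 p.2)},
      Mb y !=set0,
      forall m A z, (0 < m)%N -> is_interval A -> A `<=` J y m ->
        A (tau y m.-1) -> is_solution (ode y m) A z -> Mb y (z (tau y m.-1)) ->
        exists2 z', is_solution (ode y m) (J y m) z' & {in A, z' =1 z} &
      forall (z : nat -> R -> 'cV[R]_n) (Z : R -> 'cV[R]_n) x0,
        (forall m, (0 < m)%N ->
           is_solution (ode y m) (J y m) (z m) /\ Mb y (z m (tau y m.-1))) ->
        (forall m t, (0 < m)%N -> tau y m <= t < tau y m.+1 -> Z t = z m t) ->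
        M x0 -> (forall t, t0 <= t -> y t = out (x t t0 x0)) ->
        (fun t => x t t0 x0 - Z t) @ +oo --> (0 : 'cV[R]_n)].

(* State (x1, x2) encoded as the column vector [col_mx x1 x2]; output x1. *)
Definition triangular_system (R : realType) (n1 n2 : nat)
    (f1 : R -> 'cV[R]_n1 -> 'cV[R]_n1)
    (f2 : R -> 'cV[R]_n1 -> 'cV[R]_n2 -> 'cV[R]_n2)
    (a : R -> 'cV[R]_n1 -> R) (B : R -> 'cV[R]_n1 -> 'M[R]_(n1, n2))
    (t : R) (x : 'cV[R]_(n1 + n2)) : 'cV[R]_(n1 + n2) :=
  let x1 := usubmx x in let x2 := dsubmx x in
  col_mx (f1 t x1 + a t x1 *: (B t x1 *m x2)) (f2 t x1 x2).

(* Main.v *)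
Require Import Defs.
From mathcomp Require Import ring lra.

(* The observer knows the past of y, so at the switching time tau_(m-1) it may
   select an initial state u_m in M, of nearly minimal norm, whose output agrees
   with y on [t0, tau_(m-1)]; this choice is causal.  If x0 is the true initial
   state, then |u_m| <= |x0| + 1, and since a <> 0 the difference e of the two
   x2-components lies in ker B as long as the outputs agree.  There e' P e decays
   like exp (-2 int d), uniformly in m, so at tau_(m-1) the trajectories from x0
   and u_m are close for large m.  On [tau_(m-1), tau_(m+1)] they cannot move far
   apart because the mesh is so fine that, for every bound on |x0|, the speed
   bound times the step tends to 0.  The dynamics g_m does not depend on z: it is
   the time derivative of x(t, t0, u_m) minus an exponential that starts the
   observer at 0 and is negligible after tau_m. *)

Set Implicit Arguments.
Unset Strict Implicit.
Unset Printing Implicit Defensive.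

Local Open Scope classical_set_scope.
Local Open Scope ring_scope.

(** * Derivatives along a set *)

Section DeriveWithin.
Context {R : realType} {V : normedModType R}.
Implicit Types (A B : set R) (f g : R -> V) (t : R).

Lemma is_derive_withinW A B f t df : B `<=` A ->
  is_derive_within A f t df -> is_derive_within B f t df.
Proof.
move=> BA; apply: cvg_trans; apply: cvg_app.
move=> U AU; change (\forall s \near t, s != t -> B s -> U s).
change (\forall s \near t, s != t -> A s -> U s) in AU.
apply: filterS AU.
by move=> s sU st /BA; exact: sU.
Qed.

Lemma is_derive_withinB A f g t df dg :
  is_derive_within A f t df -> is_derive_within A g t dg ->
  is_derive_within A (f \- g) t (df - dg).
Proof.
rewrite /is_derive_within => /cvgB/[apply]; apply: cvg_trans.
rewrite [X in X @ _ `=>` _](_ : _ =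
  (fun s => (s - t)^-1 *: (f s - f t)) \- (fun s => (s - t)^-1 *: (g s - g t)))//.
apply/funext => s /=; rewrite -scalerBr; congr (_ *: _).
by rewrite !opprD !opprK addrACA.
Qed.

Lemma is_derive_within_eq A f g t df : {in A, f =1 g} -> A t ->
  is_derive_within A f t df -> is_derive_within A g t df.
Proof.
move=> fg At fd U Udf.
have : \forall s \near t, s != t -> A s ->
    U ((s - t)^-1 *: (f s - f t)) := fd U Udf.
change ((\forall s \near t, s != t -> A s -> U ((s - t)^-1 *: (f s - f t))) ->
  \forall s \near t, s != t -> A s -> U ((s - t)^-1 *: (g s - g t))).
by apply: filterS => s + st As => /(_ st As); rewrite !fg ?inE.
Qed.

(** [f s] is [f t] plus [s - t] times the difference quotient, a product that tends to 0; the point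
    [s = t], invisible to the punctured filter, is treated apart. *)
Lemma is_derive_within_continuous A f t df :
  is_derive_within A f t df -> f @ within A (nbhs t) --> f t.
Proof.
move=> fd; have FA : Filter (within A t^') by exact: within_filter.
have st0 : (fun s => s - t) @ within A t^' --> 0.
  rewrite -[X in _ --> X](subrr t).
  apply: cvgB; last exact: cvg_cst.
  by apply: cvg_trans (@nbhs_dnbhs _ t); exact: cvg_within.
have := cvgD (@cvg_cst _ (f t) _ _ _) (cvgZ st0 fd).
rewrite scale0r addr0 => H U Ut.
change (\forall s \near t, A s -> U (f s)).
have {}H : nbhs t (fun s => s != t -> A s ->
    U (f t + (s - t) *: ((s - t)^-1 *: (f s - f t))))  :=
  H FA FA FA U Ut.
apply: filterS H => s sP As.
have [->|st] := eqVneq s t; first exact: nbhs_singleton.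
have := sP st As; rewrite scalerA divff ?subr_eq0// scale1r.
by rewrite addrC subrK.
Qed.

(** Near an interior point the set imposes no constraint, so the derivative is two-sided and unique.
    The mean value theorem and the comparison of two derivatives of one output rest on this. *)
Lemma is_derive_within_interior A f t df :
  nbhs t A -> is_derive_within A f t df -> is_derive t 1 f df.
Proof.
move=> At fd.
suff H : h^-1 *: ((f \o shift t) (h *: 1) - f t) @[h --> 0^'] --> df.
  by split; [apply/cvg_ex; exists df | exact: cvg_lim].
move=> U Udf; have : \forall s \near t, s != t -> A s ->
    U ((s - t)^-1 *: (f s - f t)) := fd U Udf.
change (\forall s \near t, A s) in At.
rewrite (near_shift 0) subr0 => sP.
move: At; rewrite (near_shift 0) subr0 => At.
near_simpl; near=> h => /=.
have -> : h *: (1 : R^o) = h by rewrite /GRing.scale/= mulr1.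
have h0 : h != 0 by near: h; exact: nbhs_dnbhs_neq.
have Aht : (A \o shift t) h by near: h; exact: nbhs_dnbhs.
have := near (nbhs_dnbhs sP) h; rewrite /= addrK; apply => //.
by rewrite -subr_eq0 addrK.
Unshelve. all: by end_near. Qed.

End DeriveWithin.

Lemma is_derive_within_entry {R : realType} m n (A : set R)
    (f : R -> 'M[R]_(m, n)) t df i j :
  is_derive_within A f t df ->
  is_derive_within (V := R) A (fun s => f s i j) t (df i j).
Proof.
move=> fd; rewrite /is_derive_within.
have -> : (fun s => (s - t)^-1 *: (f s i j - f t i j : R^o)) =
    (fun M : 'M[R]_(m, n) => M i j) \o (fun s => (s - t)^-1 *: (f s - f t)).
  by apply/funext => s /=; rewrite !mxE.
exact: (cvg_comp _ _ fd (@coord_continuous _ _ _ i j df)).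
Qed.

(** * Matrix sup norm and mean value inequality *)

Lemma mx_norm_le {R : realType} m n (A : 'M[R]_(m, n)) (k : R) :
  0 <= k -> (forall i j, `|A i j| <= k) -> `|A| <= k.
Proof.
move=> k0 Ak; rewrite /Num.Def.normr/= mx_normrE.
by apply: bigmax_le => // -[i j] _; exact: Ak.
Qed.

Lemma mx_norm_entry {R : realType} m n (A : 'M[R]_(m, n)) i j : `|A i j| <= `|A|.
Proof.
rewrite [leRHS]/Num.Def.normr/= mx_normrE.
exact: (@le_bigmax _ _ _ 0 (fun ij => `|A ij.1 ij.2|) (i, j)).
Qed.

(** Applied entry by entry, the scalar mean value theorem loses no constant, since the norm is the
    sup norm. *)
Lemma mean_value_le {R : realType} m n (f df : R -> 'M[R]_(m, n)) (a b k : R) :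
  a <= b -> 0 <= k ->
  (forall s, a <= s <= b -> is_derive_within `[a, b] f s (df s)) ->
  (forall s, a <= s <= b -> `|df s| <= k) ->
  `|f b - f a| <= k * (b - a).
Proof.
move=> ab k0 fd dfk; apply: mx_norm_le => [|i j].
  by rewrite mulr_ge0 // subr_ge0.
have ifd s : a <= s <= b ->
    is_derive_within (V := R) `[a, b] (fun s => f s i j) s (df s i j).
  by move=> sab; exact/is_derive_within_entry/fd.
have [||c] := @MVT_segment _ (fun s => f s i j) (fun s => df s i j) _ _ ab.
- move=> s sab; apply: (@is_derive_within_interior _ _ `[a, b]).
    by apply: filterS (near_in_itvoo sab); exact: subset_itv_oo_cc.
  by apply: ifd; move: sab; rewrite in_itv/= => /andP[/ltW-> /ltW->].
- apply/subspace_continuousP => s; rewrite /= in_itv/= => sab.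
  exact: (is_derive_within_continuous (ifd _ sab)).
rewrite in_itv/= !mxE => cab ->.
rewrite normrM (ger0_norm (_ : 0 <= b - a)) ?subr_ge0// ler_wpM2r ?subr_ge0//.
exact: le_trans (mx_norm_entry _ _ _) (dfk _ cab).
Qed.

(** * Euclidean norm and quadratic forms *)

Section EuclideanNorm.
Context {R : realType}.

Lemma enorm_ge0 n (v : 'cV[R]_n) : 0 <= enorm v.
Proof. exact: sqrtr_ge0. Qed.

Lemma sqr_enorm n (v : 'cV[R]_n) : enorm v ^+ 2 = \sum_i v i 0 ^+ 2.
Proof. by rewrite sqr_sqrtr// sumr_ge0// => i _; exact: sqr_ge0. Qed.

Lemma sqr_enormE n (v : 'cV[R]_n) : enorm v ^+ 2 = (v^T *m v) 0 0.
Proof.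
by rewrite sqr_enorm mxE; apply: eq_bigr => i _; rewrite mxE expr2.
Qed.

Lemma norm_le_enorm n (v : 'cV[R]_n) : `|v| <= enorm v.
Proof.
apply: mx_norm_le => [|i j]; first exact: enorm_ge0.
rewrite ord1 -sqrtr_sqr ler_wsqrtr// (bigD1 i)//= lerDl.
by rewrite sumr_ge0// => k _; exact: sqr_ge0.
Qed.

Lemma enorm_dsubmx_le m n (v : 'cV[R]_(m + n)) : enorm (dsubmx v) <= enorm v.
Proof.
rewrite /enorm ler_wsqrtr// big_split_ord/= ler_wpDl//.
  by rewrite sumr_ge0// => k _; exact: sqr_ge0.
by apply: ler_sum => i _; rewrite mxE.
Qed.

Lemma sqr_enormB_le n (u v : 'cV[R]_n) :
  enorm (u - v) ^+ 2 <= 2 * (enorm u ^+ 2 + enorm v ^+ 2).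
Proof.
rewrite !sqr_enorm -big_split/= mulr_sumr; apply: ler_sum => i _.
rewrite !mxE -subr_ge0.
rewrite (_ : _ - _ = (u i 0 + v i 0) ^+ 2) ?sqr_ge0//; ring.
Qed.

Lemma sqr_enorm_continuous n : continuous (fun v : 'cV[R]_n => enorm v ^+ 2).
Proof.
have -> : (fun v : 'cV[R]_n => enorm v ^+ 2) = (fun v => \sum_i v i 0 ^+ 2).
  by apply/funext => v; exact: sqr_enorm.
apply: continuous_big => [|i _]; first exact: add_continuous.
have -> : (fun v : 'cV[R]_n => v i 0 ^+ 2) = (fun v => v i 0 * v i 0).
  by apply/funext => v; exact: expr2.
by move=> v; apply: cvgM; [exact: nbhs_filter|exact: coord_continuous..].
Qed.

Lemma enorm_continuous n : continuous (@enorm R n).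
Proof.
move=> v.
have -> : @enorm R n = Num.sqrt \o (fun v : 'cV[R]_n => enorm v ^+ 2).
  by apply/funext => w /=; rewrite sqrtr_sqr ger0_norm// enorm_ge0.
apply: continuous_comp; first exact: sqr_enorm_continuous.
exact: sqrt_continuous.
Qed.

Lemma enormZ n (k : R) (v : 'cV[R]_n) : enorm (k *: v) = `|k| * enorm v.
Proof.
rewrite /enorm -sqrtr_sqr -sqrtrM ?sqr_ge0// mulr_sumr.
by congr Num.sqrt; apply: eq_bigr => i _; rewrite mxE exprMn.
Qed.

Lemma enorm_eq0 n (v : 'cV[R]_n) : (enorm v == 0) = (v == 0).
Proof.
apply/eqP/eqP => [v0|->].
  by apply/eqP; rewrite -normr_le0 -v0 norm_le_enorm.
have := enormZ 0 (0 : 'cV[R]_n); by rewrite scale0r normr0 mul0r.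
Qed.

Lemma qformZ n (A : 'M[R]_n) k v : qform A (k *: v) = k ^+ 2 * qform A v.
Proof.
have kvE : (k *: v)^T = k *: v^T by apply/matrixP => i j; rewrite !mxE.
by rewrite /qform kvE -!scalemxAl -scalemxAr scalerA -expr2 mxE.
Qed.

Lemma enorm_mulmx_le m n (A : 'M[R]_(m, n)) v : enorm v = 1 ->
  enorm (A *m v) <= opnorm A.
Proof.
move=> v1; apply: ub_le_sup; last by exists v.
(* The supremum is an upper bound only of a bounded set. Entries of a unit vector are at most 1 in
   absolute value, so the absolute row sums give a bound. *)
exists (Num.sqrt (\sum_i (\sum_j `|A i j|) ^+ 2)) => _ [w w1 <-].
rewrite ler_wsqrtr// ler_sum// => i _.
rewrite mxE -real_normK ?num_real// lerXn2r ?nnegrE//; first by rewrite sumr_ge0.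
rewrite (le_trans (ler_norm_sum _ _ _))//; apply: ler_sum => j _.
rewrite normrM ler_piMr//.
by rewrite (le_trans (mx_norm_entry w _ _))// -w1 norm_le_enorm.
Qed.

(* By AM-GM [u' (A u) <= (|u|^2 + |A u|^2) / 2] for a unit vector [u], which
   spares the Cauchy-Schwarz inequality. *)
Lemma qform_le_opnorm n (A : 'M[R]_n) (L : R) v : opnorm A <= L ->
  qform A v <= (1 + L ^+ 2) / 2 * enorm v ^+ 2.
Proof.
move=> AL.
have [->|v0] := eqVneq v 0.
  have /eqP -> : enorm (0 : 'cV[R]_n) == 0 by rewrite enorm_eq0.
  by rewrite expr0n/= mulr0 /qform mulmx0 mxE.
have ev0 : enorm v != 0 by rewrite enorm_eq0.
pose u := (enorm v)^-1 *: v.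
have u1 : enorm u = 1.
  by rewrite enormZ ger0_norm ?invr_ge0 ?enorm_ge0// mulVf.
have -> : v = enorm v *: u by rewrite scalerA divff// scale1r.
rewrite qformZ enormZ u1 mulr1 real_normK ?num_real// mulrC.
rewrite ler_wpM2r ?sqr_ge0//.
apply: (@le_trans _ _ ((enorm u ^+ 2 + enorm (A *m u) ^+ 2) / 2)).
  rewrite /qform -mulmxA !sqr_enorm -big_split/= mxE mulr_suml.
  apply: ler_sum => i _; rewrite mxE.
  set a := u i 0; set b := (A *m u) i 0.
  have := sqr_ge0 (a - b); nra.
have AuL := le_trans (enorm_mulmx_le A u1) AL.
rewrite u1 expr1n ler_wpM2r// lerD2l lerXn2r ?nnegrE ?enorm_ge0//.
exact: le_trans (enorm_ge0 _) AuL.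
Qed.

Lemma qform1 n (v : 'cV[R]_n) : qform 1%:M v = enorm v ^+ 2.
Proof. by rewrite /qform mulmx1 sqr_enormE. Qed.

Lemma qformE n (A : 'M[R]_n) v :
  qform A v = \sum_j \sum_i v i 0 * A i j * v j 0.
Proof.
rewrite /qform mxE; apply: eq_bigr => j _; rewrite mxE mulr_suml.
by apply: eq_bigr => i _; rewrite mxE.
Qed.

Lemma is_derive_qform n (A : set R) (P : R -> 'M[R]_n) (e : R -> 'cV[R]_n)
    t dP de : nbhs t A ->
  is_derive_within A P t dP -> is_derive_within A e t de ->
  is_derive t 1 (fun s => qform (P s) (e s))
    ((de^T *m P t *m e t + (e t)^T *m dP *m e t + (e t)^T *m P t *m de) 0 0).
Proof.
move=> At Pd ed.
have eid i : is_derive t (1 : R) (fun s => e s i 0) (de i 0).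
  exact/(is_derive_within_interior At)/is_derive_within_entry.
have Pijd i j : is_derive t (1 : R) (fun s => P s i j) (dP i j).
  exact/(is_derive_within_interior At)/is_derive_within_entry.
have -> : (fun s => qform (P s) (e s)) = \sum_j \sum_i
    (fun s => e s i 0) * (fun s => P s i j) * (fun s => e s j 0).
  apply/funext => s; rewrite qformE fct_sumE; apply: eq_bigr => j _.
  by rewrite fct_sumE; apply: eq_bigr.
apply: is_derive_eq.
rewrite !mxE -!big_split/=; apply: eq_bigr => j _.
rewrite !mxE !mulr_suml -!big_split/=; apply: eq_bigr => i _.
rewrite !mxE.
rewrite /GRing.scale/= fctE; ring.
Qed.

End EuclideanNorm.

(** * Decay of a dissipated quadratic form *)

Section Gronwall.
Context {R : realType}.
Notation mu := (@lebesgue_measure R).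

(** Integrating factor: [W = V * expR (2 * I)], with [I] the integral of [d] from [a], has
    nonpositive derivative, so the mean value theorem gives [W c <= W a = V a]. *)
Lemma Gronwall_decay (d V dV : R -> R) (a c : R) : a < c ->
  {within `[a, c], continuous d} -> {within `[a, c], continuous V} ->
  (forall t, t \in `]a, c[ -> is_derive t 1 V (dV t)) ->
  (forall t, t \in `]a, c[ -> dV t <= - (2 * d t) * V t) ->
  V c <= V a * expR (- (2 * (\int[mu]_(s in `[a, c]) d s)%R)).
Proof.
move=> ac cd cV dVd dVle.
pose I (t : R) := (\int[mu]_(s in `[a, t]) d s)%R.
have iD : mu.-integrable `[a, c] (EFin \o d).
  by apply: continuous_compact_integrable cd; exact: segment_compact.
have cI : {within `[a, c], continuous I}.
  exact: (parameterized_integral_continuous (ltW ac) iD).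
have dI t : t \in `]a, c[ -> is_derive t 1 I (d t).
  move=> tac; move: (tac); rewrite in_itv/= => /andP[at_ tc].
  have [||IE I'] := @continuous_FTC1_closed _ d a t c tc iD => //.
    exact: (within_continuous_continuous _ cd).
  by apply: DeriveDef => //; rewrite -derive1E.
pose W t := V t * expR (2 * I t).
have cW : {within `[a, c], continuous W}.
  apply/subspace_continuousP => t tac; apply: cvgM.
    by move/subspace_continuousP : cV; exact.
  apply: (cvg_comp (fun t => 2 * I t) expR); last exact: continuous_expR.
  apply: cvgM; first exact: cvg_cst.
  by move/subspace_continuousP : cI; exact.
have dW t : t \in `]a, c[ ->
    is_derive t 1 W ((dV t + 2 * d t * V t) * expR (2 * I t)).
  move=> tac; have := dVd t tac; have := dI t tac => ? ?.
  have ? : is_derive t 1 (fun t => 2 * I t) (2 * d t).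
    have -> : (fun t => 2 * I t) = 2 *: I by apply/funext.
    exact: is_deriveZ.
  have ? : is_derive t 1 (fun t => expR (2 * I t)) (expR (2 * I t) * (2 * d t)).
    apply: (@is_derive1_comp _ expR (fun t => 2 * I t)).
  apply: is_derive_eq; rewrite /GRing.scale/=; ring.
have [t tac] := MVT ac dW cW.
have Ia : I a = 0 by rewrite /I set_itv1 Rintegral_set1.
rewrite /W Ia mulr0 expR0 mulr1 => WE.
have : V c * expR (2 * I c) <= V a.
  rewrite -subr_le0 WE mulr_le0_ge0 ?subr_ge0 ?(ltW ac)//.
  rewrite mulr_le0_ge0 ?expR_ge0//.
  by have := dVle t tac; lra.
by rewrite expRN -ler_pdivlMr ?invrK// expR_gt0.
Qed.

End Gronwall.

(** * From the quadratic form to the norm of the error *)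

Section Decay.
Context {R : realType} {n : nat}.
Notation mu := (@lebesgue_measure R).
Variables (P dP : R -> 'M[R]_n) (d : R -> R) (a T xi eps L : R).
Variables (e de : R -> 'cV[R]_n).
Hypotheses (aT : a <= T) (L1 : 1 < L) (xi0 : 0 < xi).
Hypothesis Pd : forall t, a <= t <= T -> is_derive_within `[a, T] P t (dP t).
Hypothesis Psym : forall t, a <= t <= T -> (P t)^T = P t.
Hypothesis cd : {within `[a, T], continuous d}.
Hypothesis P_ge1 : forall t, a <= t <= T -> mxle 1%:M (P t).
Hypothesis PaL : opnorm (P a) <= L.
Hypothesis int_d : forall t, a <= t <= T ->
  - eps < (\int[mu]_(s in `[a, t]) d s)%R.
Hypothesis ed : forall t, a <= t <= T -> is_derive_within `[a, T] e t (de t).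
Hypothesis dissip : forall t, a < t < T -> enorm (e t) <= xi ->
  exists2 A : 'M[R]_n, de t = A *m e t &
    qform (P t *m A) (e t) + 2^-1 * qform (dP t) (e t)
      <= - d t * qform (P t) (e t).
Hypothesis xi_large :
  (1 + L ^+ 2) / 2 * enorm (e a) ^+ 2 * expR (2 * eps) < xi ^+ 2.

Let bound t := (1 + L ^+ 2) / 2 * enorm (e a) ^+ 2 *
  expR (- (2 * (\int[mu]_(s in `[a, t]) d s)%R)).

(** For [V = e' P e] the symmetry of [P] makes [dV] twice the left side of [dissip], so [V] decays.
    [P >= I] bounds [enorm (e c) ^+ 2] by [V c], and [opnorm (P a) <= L] bounds [V a]. *)
Let decay_until c : a < c <= T ->
  (forall t, t \in `]a, c[ -> enorm (e t) <= xi) ->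
  enorm (e c) ^+ 2 <= bound c.
Proof.
move=> /andP[ac cT] exi.
have sacT : `[a, c] `<=` `[a, T].
  by apply: subset_itvl; rewrite bnd_simp.
have acT t : t \in `]a, c[ -> a <= t <= T.
  rewrite in_itv/= => /andP[/ltW-> /ltW tc]; exact: le_trans tc cT.
pose V t := qform (P t) (e t).
pose dV t := ((de t)^T *m P t *m e t + (e t)^T *m dP t *m e t +
  (e t)^T *m P t *m de t) 0 0.
have Vd t : t \in `]a, c[ -> is_derive t 1 V (dV t).
  move=> tac; apply: (@is_derive_qform _ _ `[a, T]).
  - apply: filterS (near_in_itvoo tac) => s.
    by move/subset_itv_oo_cc/sacT.
  - exact/Pd/acT.
  - exact/ed/acT.
have cV : {within `[a, c], continuous V}.
  apply: (continuous_subspaceW sacT).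
  have -> : V = fun t => \sum_j \sum_i e t i 0 * P t i j * e t j 0.
    by apply/funext => t; exact: qformE.
  apply/subspace_continuousP => t /=; rewrite in_itv/= => taT.
  have ce i : e t i 0 @[t --> within `[a, T] (nbhs t)] --> e t i 0.
    exact: (is_derive_within_continuous (is_derive_within_entry (ed taT))).
  have cP i j : P t i j @[t --> within `[a, T] (nbhs t)] --> P t i j.
    exact: (is_derive_within_continuous (is_derive_within_entry (Pd taT))).
  apply: cvg_big => [|j _]; first exact: add_continuous.
  apply: cvg_big => [|i _]; first exact: add_continuous.
  by apply: cvgM; [apply: cvgM|].
have dVle t : t \in `]a, c[ -> dV t <= - (2 * d t) * V t.
  move=> tac; have taT := acT _ tac.
  have taT' : a < t < T.
    by move: tac; rewrite in_itv/= => /andP[-> tc]; exact: lt_le_trans tc cT.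
  have [A deA] := dissip taT' (exi _ tac).
  have -> : dV t = 2 * (qform (P t *m A) (e t) + 2^-1 * qform (dP t) (e t)).
    have -> : dV t = ((de t)^T *m P t *m e t) 0 0 + qform (dP t) (e t) +
        ((e t)^T *m P t *m de t) 0 0 by rewrite /dV mxE [X in X + _]mxE.
    have -> : (de t)^T *m P t *m e t = ((e t)^T *m P t *m de t)^T.
      by rewrite !trmx_mul trmxK Psym// mulmxA.
    rewrite [X in X + _ + _]mxE deA /qform !mulmxA. lra.
  by move=> H; rewrite /V; nra.
have cdac : {within `[a, c], continuous d} by exact: continuous_subspaceW cd.
have := Gronwall_decay ac cdac cV Vd dVle.
have cT' : a <= c <= T by rewrite (ltW ac).
rewrite -qform1 => Vc; apply: (le_trans (P_ge1 cT' _)).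
apply: (le_trans Vc); rewrite ler_wpM2r ?expR_ge0//.
exact: qform_le_opnorm.
Qed.

(** The integral of [d] stays above [- eps], so the exponential never exceeds the one in
    [xi_large]. *)
Let bound_lt t : a <= t <= T -> bound t < xi ^+ 2.
Proof.
move=> taT; apply: le_lt_trans xi_large.
rewrite ler_wpM2l//.
  by rewrite mulr_ge0 ?sqr_ge0// divr_ge0// addr_ge0// sqr_ge0.
by rewrite ler_expR; have := int_d taT; lra.
Qed.

Let enorm_a : enorm (e a) ^+ 2 <= (1 + L ^+ 2) / 2 * enorm (e a) ^+ 2.
Proof.
rewrite ler_peMl ?sqr_ge0//; have := exprn_ege1 2 (ltW L1); lra.
Qed.

Let bound_a : enorm (e a) ^+ 2 <= bound a.
Proof.
rewrite /bound set_itv1 Rintegral_set1 mulr0 oppr0 expR0 mulr1.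
exact: enorm_a.
Qed.

(* The dissipation inequality is only available while [|e| <= xi]; at a first
   exit time it would give [|e| < xi]. *)
Lemma enorm_le_decay : enorm (e T) ^+ 2 <= (1 + L ^+ 2) / 2 *
  enorm (e a) ^+ 2 * expR (- (2 * (\int[mu]_(s in `[a, T]) d s)%R)).
Proof.
have [exi|/existsNP[t1 /not_implyP[t1aT /negP]]] :=
    pselect (forall t, a <= t <= T -> enorm (e t) <= xi).
  move: aT; rewrite le_eqVlt => /predU1P[<-|aT']; first exact: bound_a.
  apply: decay_until => [|t]; first by rewrite aT' lexx.
  by rewrite in_itv/= => /andP[/ltW at_ /ltW tT]; rewrite exi// at_.
rewrite -ltNge => xit1; exfalso.
(* The infimum [c] of [S] is the first time at which the error reaches [xi]. *)
pose S := [set t | a <= t <= T /\ xi <= enorm (e t)].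
have S1 : S t1 by split => //; exact: ltW.
have Sa : lbound S a by move=> t [/andP[]].
have iS : has_inf S by split; [exists t1 | exists a].
pose c := inf S.
have ac : a <= c by apply: lb_le_inf => //; exists t1.
have cT : c <= T.
  by apply: (le_trans (ge_inf _ S1)); [exists a | case/andP : t1aT].
(* If the error were below [xi] at [c], continuity would keep it so near [c], where [S] has
   points. *)
have xic : xi <= enorm (e c).
  rewrite leNgt; apply/negP => ecxi.
  have caT : a <= c <= T by rewrite ac.
  have cv : enorm (e t) @[t --> within `[a, T] (nbhs c)] --> enorm (e c).
    apply: (cvg_comp e (@enorm R n)); last exact: enorm_continuous.
    exact: is_derive_within_continuous (ed caT).
  have /nbhs_ballP[r /= r0 cr] : \forall t \near c, t \in `[a, T] -> enorm (e t) < xi.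
    exact: (cvgr_lt _ cv _ ecxi).
  have [t [taT xit] tcr] := inf_adherent r0 iS.
  have ct : c <= t by apply: ge_inf => //; exists a.
  have : enorm (e t) < xi.
    apply: cr; last by rewrite in_itv.
    by rewrite -ball_normE/= ler0_norm ?subr_le0// opprB ltrBlDl.
  by rewrite ltNge xit.
have lt_a : a < c.
  rewrite lt_neqAle ac andbT; apply/eqP => ca.
  have := bound_lt (_ : a <= a <= T); rewrite lexx aT => /(_ isT).
  apply/negP; rewrite -leNgt; apply: le_trans bound_a.
  by rewrite ca lerXn2r ?nnegrE ?enorm_ge0// ltW.
(* Before [c] the error is below [xi], so the decay estimate holds up to [c] and contradicts
   [xic]. *)
have : enorm (e c) ^+ 2 <= bound c.
  apply: decay_until => [|t]; first by rewrite lt_a.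
  rewrite in_itv/= => /andP[at_ tc]; rewrite leNgt; apply/negP => xit.
  have : c <= t.
    apply: ge_inf; first by exists a.
    by split; [rewrite (ltW at_) (le_trans (ltW tc)) | exact: ltW].
  by rewrite leNgt tc.
have /bound_lt bc : a <= c <= T by rewrite ac.
move/le_lt_trans => /(_ _ bc); apply/negP; rewrite -leNgt.
by rewrite lerXn2r ?nnegrE ?enorm_ge0// ltW.
Qed.

End Decay.

(** * Continuity on a half-space *)

Section HalfSpace.
Context {R : realType}.

Lemma cvg_mx {T : Type} (F : set_system T) {FF : Filter F} m n
    (f : T -> 'M[R]_(m, n)) (l : 'M[R]_(m, n)) :
  (forall i j, f z i j @[z --> F] --> l i j) -> f @ F --> l.
Proof.
move=> fl; apply/cvgrPdist_le => e e0.
have H : \forall z \near F, forall i, forall j, `|l i j - f z i j| <= e.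
  apply: filter_forall => i; apply: filter_forall => j.
  by move/cvgrPdist_le : (fl i j); exact.
apply: filterS H => z H.
by apply: mx_norm_le => [|i j]; [exact: ltW|rewrite !mxE].
Qed.

Lemma cvg_entry {T : Type} (F : set_system T) {FF : Filter F} m n
    (f : T -> 'M[R]_(m, n)) (l : 'M[R]_(m, n)) i j :
  f @ F --> l -> f z i j @[z --> F] --> l i j.
Proof. by move=> fl; exact: (cvg_comp _ _ fl (@coord_continuous _ _ _ i j l)). Qed.

(** Stated for an arbitrary filter, it serves both limits in the product space and limits along a
    time interval. *)
Lemma C0_halfspace_cvg (V W : normedModType R) (G : R -> V -> W) {T : Type}
    (F : set_system T) {FF : Filter F} (s : T -> R) (w : T -> V)
    (s0 : R) (w0 : V) :
  C0_halfspace G -> 0 <= s0 -> (\forall z \near F, 0 <= s z) ->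
  s @ F --> s0 -> w @ F --> w0 -> G (s z) (w z) @[z --> F] --> G s0 w0.
Proof.
move=> /subspace_continuousP cG s00 sge0 ss ww.
have H := cG (s0, w0) s00.
apply: (cvg_comp (fun z => (s z, w z)) (fun p => G p.1 p.2) _ H).
move=> U [[/= U1 U2] [sU1 wU2] UU].
have sF : F [set z | U1 (s z)] := ss _ sU1.
have wF : F [set z | U2 (w z)] := ww _ wU2.
change (F [set z | U (s z, w z)]).
change (F [set z | 0 <= s z]) in sge0.
apply: filterS (filterI sge0 (filterI sF wF)) => z [z0 [Us Uw]].
by apply: (UU (s z, w z)).
Qed.

Lemma C0_halfspace_bounded m n (G : R -> 'cV[R]_m -> 'cV[R]_n) (N : R) :
  C0_halfspace G -> exists2 K, 0 <= K &
    forall s v, 0 <= s <= N -> `|v| <= N -> `|G s v| <= K.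
Proof.
move=> cG.
(* [S] is a compact box containing all the pairs at stake; its vector part is a transposed cube of
   row vectors, to which [rV_compact] applies. *)
pose S : set (R * 'cV[R]_m) := `[0, N] `*`
  (trmx @` [set v : 'rV[R]_m | forall i, `[- N, N]%classic (v 0 i)]).
have cS : compact S.
  apply: compact_setX; first exact: segment_compact.
  apply: continuous_compact.
    apply: continuous_subspaceT => v.
    apply: (cvg_mx (FF := nbhs_filter v)) => i j.
    by rewrite mxE; under eq_fun do rewrite mxE; exact: coord_continuous.
  by apply: (@rV_compact R m (fun=> `[- N, N]%classic)) => _; exact: segment_compact.
have /compact_bounded/pinfty_ex_gt0[K K0 GK] :
    compact ((fun p => G p.1 p.2) @` S).
  apply: continuous_compact cS; apply: continuous_subspaceW cG.
  by move=> [s v] [/=]; rewrite in_itv/= => /andP[].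
exists K => [|s v s0N vN]; first exact: ltW.
apply: GK; exists (s, v) => //; split => /=; first by rewrite in_itv.
exists v^T; last exact: trmxK.
by move=> i /=; rewrite mxE in_itv/= -ler_norml (le_trans (mx_norm_entry _ _ _)).
Qed.

Lemma mulmx_cvg {T : Type} (F : set_system T) {FF : Filter F} m n p
    (f : T -> 'M[R]_(m, n)) (g : T -> 'M[R]_(n, p))
    (A : 'M[R]_(m, n)) (B : 'M[R]_(n, p)) :
  f @ F --> A -> g @ F --> B -> f z *m g z @[z --> F] --> A *m B.
Proof.
move=> fA gB; apply: cvg_mx => i j; rewrite mxE; under eq_fun do rewrite mxE.
apply: cvg_big => [|k _]; first exact: add_continuous.
by apply: cvgM; exact: cvg_entry.
Qed.

Lemma col_mx_cvg {T : Type} (F : set_system T) {FF : Filter F} m n p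
    (f : T -> 'M[R]_(m, p)) (g : T -> 'M[R]_(n, p))
    (A : 'M[R]_(m, p)) (B : 'M[R]_(n, p)) :
  f @ F --> A -> g @ F --> B -> col_mx (f z) (g z) @[z --> F] --> col_mx A B.
Proof.
move=> fA gB; apply: cvg_mx => i j; rewrite mxE; under eq_fun do rewrite mxE.
by case: (fintype.split i) => k; exact: cvg_entry.
Qed.

Lemma usubmx_continuous m n p :
  continuous (usubmx : 'M[R]_(m + n, p) -> 'M[R]_(m, p)).
Proof.
move=> v; apply: (cvg_mx (FF := nbhs_filter v)) => i j.
rewrite mxE; under eq_fun do rewrite mxE.
exact: coord_continuous.
Qed.

Lemma dsubmx_continuous m n p :
  continuous (dsubmx : 'M[R]_(m + n, p) -> 'M[R]_(n, p)).
Proof.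
move=> v; apply: (cvg_mx (FF := nbhs_filter v)) => i j.
rewrite mxE; under eq_fun do rewrite mxE.
exact: coord_continuous.
Qed.

Lemma triangular_system_C0 (n1 n2 : nat)
    (f1 : R -> 'cV[R]_n1 -> 'cV[R]_n1)
    (f2 : R -> 'cV[R]_n1 -> 'cV[R]_n2 -> 'cV[R]_n2)
    (a : R -> 'cV[R]_n1 -> R) (B : R -> 'cV[R]_n1 -> 'M[R]_(n1, n2)) :
  C0_halfspace f1 ->
  C0_halfspace (fun t (p : 'cV[R]_n1 * 'cV[R]_n2) => f2 t p.1 p.2) ->
  C0_halfspace a -> C0_halfspace B ->
  C0_halfspace (triangular_system f1 f2 a B).
Proof.
move=> cf1 cf2 ca cB; apply/subspace_continuousP => -[t v] /= t0.
set F := within _ _.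
have FF : Filter F by exact: within_filter.
have F0 : \forall z \near F, 0 <= z.1.
  by rewrite /F nearE /within/=; near=> z.
have F1 : z.1 @[z --> F] --> t.
  apply: (@cvg_trans _ (fst @ nbhs (t, v))); last exact: cvg_fst.
  by apply: cvg_app; exact: cvg_within.
have F2 : z.2 @[z --> F] --> v.
  apply: (@cvg_trans _ (snd @ nbhs (t, v))); last exact: cvg_snd.
  by apply: cvg_app; exact: cvg_within.
have Fu : usubmx z.2 @[z --> F] --> usubmx v.
  exact: (cvg_comp _ _ F2 (@usubmx_continuous _ _ _ v)).
have Fd : dsubmx z.2 @[z --> F] --> dsubmx v.
  exact: (cvg_comp _ _ F2 (@dsubmx_continuous _ _ _ v)).
apply: col_mx_cvg.
  apply: cvgD; first exact: C0_halfspace_cvg.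
  apply: cvgZ; first exact: C0_halfspace_cvg.
  by apply: mulmx_cvg => //; exact: C0_halfspace_cvg.
have Fp : (usubmx z.2, dsubmx z.2) @[z --> F] --> (usubmx v, dsubmx v).
  apply: (@cvg_pair _ _ _ F (nbhs (usubmx v)) (nbhs (dsubmx v)) FF _ _ _ _ Fu Fd).
exact: (C0_halfspace_cvg cf2 t0 F0 F1 Fp).
Unshelve. all: by end_near. Qed.

End HalfSpace.

(** * The observer *)

(* The step is a nonincreasing function of time, so a bounded mesh would have
   steps bounded away from 0. *)
Lemma exists_fine_mesh (R : realType) (K : nat -> R) (t0 : R) :
  0 <= t0 -> (forall n, 0 <= K n) ->
  exists tau : nat -> R,
    [/\ tau 0%N = t0, tau 1%N = t0,
        forall m, (0 < m)%N -> tau m < tau m.+1,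
        tau @ \oo --> +oo &
        forall m, (0 < m)%N -> let n := Num.truncn (tau m.-1) in
          tau m.+1 <= n.+3%:R /\
          (1 + K n.+3) * (tau m.+1 - tau m.-1) <= 2 / n.+1%:R].
Proof.
move=> t00 K0.
(* The sum makes [k] nondecreasing and at least [K n.+3]; the factor [n.+1%:R] makes the product of
   speed bound and step vanish at infinity. *)
pose k n := n.+1%:R * (1 + \sum_(i < n.+4) K i).
have S0 n : 0 <= \sum_(i < n.+4) K i by rewrite sumr_ge0.
have k0 n : 1 <= k n.
  by rewrite /k mulr_ege1 ?ler1n// lerDl.
have kS n : k n <= k n.+1.
  rewrite /k ler_pM// ?addr_ge0// ?ler_nat//.
  by rewrite lerD2l [leRHS]big_ord_recr/= lerDl.
have k_homo n p : (n <= p)%N -> k n <= k p.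
  move=> np; rewrite -(subnK np); elim: (p - n)%N => // i ih.
  by rewrite (le_trans ih).
pose h (t : R) := (k (Num.truncn t))^-1.
have h0 t : 0 < h t by rewrite invr_gt0 (lt_le_trans ltr01).
have h1 t : h t <= 1 by rewrite invf_le1 ?(lt_le_trans ltr01).
have h_homo s t : s <= t -> h t <= h s.
  move=> st; rewrite lef_pV2 ?posrE ?(lt_le_trans ltr01)//.
  exact/k_homo/le_truncn.
pose step (t : R) := t + h t.
(* The predecessor makes index 0 repeat the value at index 1. *)
pose tau m := iter m.-1 step t0.
have tauS m : (0 < m)%N -> tau m.+1 = tau m + h (tau m).
  by case: m.
have tau_lt m : (0 < m)%N -> tau m < tau m.+1.
  by move=> m0; rewrite tauS// ltrDl.
have tau_leS m : tau m <= tau m.+1.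
  by case: m => // m; apply/ltW/tau_lt.
have tau_homo : {homo tau : m n / (m <= n)%N >-> m <= n}.
  by apply: homo_leq => // x y z; exact: le_trans.
have tau0 m : 0 <= tau m by rewrite (le_trans t00)// (tau_homo 0%N).
exists tau; split => // [|m m0 n].
  apply/cvgryPge => A.
  have [[m Am]|noA] := pselect (exists m, A <= tau m).
    by exists m => // n /= mn; rewrite (le_trans Am)// tau_homo.
  have tauA m : tau m <= A.
    by rewrite leNgt; apply/negP => Am; apply: noA; exists m; exact: ltW.
  (* If all times stayed below [A], every step would be at least [h A > 0], and the growth would be
     linear. *)
  have lin m : m%:R * h A <= tau m.+1.
    elim: m => [|m ih]; first by rewrite mul0r tau0.
    rewrite tauS// -natr1 mulrDl mul1r lerD//.
    exact/h_homo/tauA.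
  exfalso; have A0 : 0 <= A := le_trans (tau0 0%N) (tauA 0%N).
  have := lin (Num.truncn (A / h A)).+1.
  apply/negP; rewrite -ltNge (le_lt_trans (tauA _))//.
  by rewrite -ltr_pdivrMr// truncnS_gt.
(* Two steps, each at most [h (tau m.-1)] because [h] is nonincreasing; for [m = 1] there is only
   one. *)
have tau2 : tau m.+1 - tau m.-1 <= 2 * h (tau m.-1).
  rewrite tauS//; case: m m0 @n => [//|[|m]] _ n.
    rewrite /tau/= addrAC subrr add0r; have := h0 t0; lra.
  have := h_homo _ _ (tau_leS m.+1); rewrite /= (tauS m.+1)//; lra.
have /andP[n1 n2] := truncn_itv (tau0 m.-1).
split.
  have : tau m.+1 <= tau m.-1 + 2 by have := h1 (tau m.-1); lra.
  by move/le_trans; apply; rewrite -!natr1; move: n2; rewrite -natr1 -/n; lra.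
apply: (@le_trans _ _ ((1 + K n.+3) * (2 * h (tau m.-1)))).
  by rewrite ler_wpM2l// addr_ge0.
rewrite /h -/n mulrCA ler_wpM2l// /k invfM mulrCA ler_piMr ?invr_ge0//.
rewrite ler_pdivrMr ?ltr_pwDl// mul1r lerD2l big_ord_recr/= lerDr.
by rewrite sumr_ge0.
Qed.

(** * Derivatives of blocks and of scalar multiples *)

Section MoreDerive.
Context {R : realType}.

Lemma is_derive_within_usubmx m n (A : set R) (f : R -> 'cV[R]_(m + n)) t df :
  is_derive_within A f t df ->
  is_derive_within A (fun s => usubmx (f s)) t (usubmx df).
Proof.
move=> fd; rewrite /is_derive_within.
have -> : (fun s => (s - t)^-1 *: (usubmx (f s) - usubmx (f t))) =
    usubmx \o (fun s => (s - t)^-1 *: (f s - f t)).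
  by apply/funext => s; apply/matrixP => i j; rewrite !mxE.
exact: (cvg_comp _ _ fd (@usubmx_continuous _ _ _ _ df)).
Qed.

Lemma is_derive_within_dsubmx m n (A : set R) (f : R -> 'cV[R]_(m + n)) t df :
  is_derive_within A f t df ->
  is_derive_within A (fun s => dsubmx (f s)) t (dsubmx df).
Proof.
move=> fd; rewrite /is_derive_within.
have -> : (fun s => (s - t)^-1 *: (dsubmx (f s) - dsubmx (f t))) =
    dsubmx \o (fun s => (s - t)^-1 *: (f s - f t)).
  by apply/funext => s; apply/matrixP => i j; rewrite !mxE.
exact: (cvg_comp _ _ fd (@dsubmx_continuous _ _ _ _ df)).
Qed.

Lemma derive_is_derive_within (A : set R) (f : R -> R) (t df : R) :
  is_derive t (1 : R) f df -> is_derive_within (V := R) A f t df.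
Proof.
move=> [fd fE]; have {fd fE} :
    h^-1 *: ((f \o shift t) (h *: (1 : R^o)) - f t) @[h --> 0^'] --> df.
  by rewrite -fE; exact: fd.
move=> fd U Udf.
have H : \forall h \near (0 : R), h != 0 -> U (h^-1 * (f (h + t) - f t)).
  have : \forall h \near (0 : R)^', U (h^-1 *: ((f \o shift t) (h *: (1 : R^o)) - f t)).
    exact: fd.
  rewrite near_withinE; apply: filterS => h /[apply].
  by rewrite /GRing.scale/= mulr1.
change (\forall s \near t, s != t -> A s -> U ((s - t)^-1 *: (f s - f t))).
rewrite (near_shift 0) subr0; apply: filterS H => h Uh ht _.
have := Uh _; rewrite /= addrK; apply.
by move: ht; rewrite /= -subr_eq0 addrK.
Qed.

Lemma is_derive_within_scalel (V : normedModType R) (A : set R) (f : R -> R)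
    (v : V) (t df : R) :
  is_derive t (1 : R) f df -> is_derive_within A (fun s => f s *: v) t (df *: v).
Proof.
move=> /(@derive_is_derive_within A) fd; rewrite /is_derive_within.
have -> : (fun s => (s - t)^-1 *: (f s *: v - f t *: v)) =
    (fun s => ((s - t)^-1 *: (f s - f t : R^o)) *: v).
  by apply/funext => s; rewrite -scalerBl scalerA.
have FF : Filter (within A t^') by exact: within_filter.
exact: (cvgZ fd (cvg_cst v)).
Qed.

End MoreDerive.

(** * Decay of the difference of two trajectories with equal outputs *)

Section Detectability.
Context {R : realType} {n1 n2 l : nat}.
Notation mu := (@lebesgue_measure R).
Variables (f1 : R -> 'cV[R]_n1 -> 'cV[R]_n1)
    (f2 : R -> 'cV[R]_n1 -> 'cV[R]_n2 -> 'cV[R]_n2)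
    (a : R -> 'cV[R]_n1 -> R) (B : R -> 'cV[R]_n1 -> 'M[R]_(n1, n2))
    (D : R -> 'cV[R]_l -> 'cV[R]_n1 -> 'M[R]_n2).
Let F := triangular_system f1 f2 a B.

(* Two states with the same output have an error [x2 - u2] in [ker B], which is
   the subspace where the dissipation inequality is assumed. *)
Lemma equal_output_decay (x u : R -> 'cV[R]_(n1 + n2)) (Q : R -> set 'cV[R]_l)
    (b : R -> R) (P dP : R -> 'M[R]_n2) (d : R -> R)
    (t0 T r xi eps L : R) :
  t0 <= T -> 1 < L -> 0 < xi ->
  is_solution F `[t0, T] x -> is_solution F `[t0, T] u ->
  (forall t, t0 <= t <= T -> usubmx (x t) = usubmx (u t)) ->
  enorm (x t0) <= r -> enorm (u t0) <= r ->
  (forall t, t0 <= t <= T -> enorm (x t) <= b t) ->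
  (forall t, t0 <= t <= T -> a t (usubmx (x t)) != 0) ->
  (forall t y x2 z2, t0 <= t ->
     (exists v : 'cV[R]_(n1 + n2), enorm v <= b t /\ y = usubmx v) ->
     enorm x2 <= b t -> enorm (x2 - z2) <= xi ->
     exists2 q, Q t q & f2 t y x2 - f2 t y z2 = D t q y *m (x2 - z2)) ->
  (forall t, t0 <= t <= T -> is_derive_within `[t0, T] P t (dP t)) ->
  (forall t, t0 <= t <= T -> (P t)^T = P t) ->
  {within `[t0, T], continuous d} ->
  (forall t, t0 <= t <= T -> mxle 1%:M (P t)) ->
  opnorm (P t0) <= L ->
  (forall t, t0 <= t <= T -> - eps < (\int[mu]_(s in `[t0, t]) d s)%R) ->
  (forall t e q, t0 <= t <= T -> B t (usubmx (x t)) *m e = 0 -> Q t q ->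
     qform (P t *m D t q (usubmx (x t))) e + 2^-1 * qform (dP t) e
       <= - d t * qform (P t) e) ->
  (1 + L ^+ 2) / 2 * (4 * r ^+ 2) * expR (2 * eps) < xi ^+ 2 ->
  `|x T - u T| ^+ 2 <= (1 + L ^+ 2) / 2 * (4 * r ^+ 2) *
    expR (- (2 * (\int[mu]_(s in `[t0, T]) d s)%R)).
Proof.
move=> t0T L1 xi0 xs us yE xr ur xb a0 f2D Pd Psym cd P1 PL int_d diss xi_large.
pose e t := dsubmx (x t - u t).
have L0 : 0 <= (1 + L ^+ 2) / 2 by rewrite divr_ge0// addr_ge0// sqr_ge0.
have ed t : t0 <= t <= T ->
    is_derive_within `[t0, T] e t (dsubmx (F t (x t) - F t (u t))).
  move=> tT; apply: is_derive_within_dsubmx; apply: is_derive_withinB.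
    by apply: xs; rewrite /= in_itv.
  by apply: us; rewrite /= in_itv.
have diss_e t : t0 < t < T -> enorm (e t) <= xi ->
    exists2 A : 'M[R]_n2, dsubmx (F t (x t) - F t (u t)) = A *m e t &
      qform (P t *m A) (e t) + 2^-1 * qform (dP t) (e t)
        <= - d t * qform (P t) (e t).
  move=> tT exi; have tT' : t0 <= t <= T by case/andP : tT => /ltW-> /ltW->.
  have eE : e t = dsubmx (x t) - dsubmx (u t) by rewrite /e linearB.
  have [q Qq f2E] : exists2 q, Q t q &
      f2 t (usubmx (x t)) (dsubmx (x t)) - f2 t (usubmx (x t)) (dsubmx (u t)) =
      D t q (usubmx (x t)) *m (dsubmx (x t) - dsubmx (u t)).
    apply: f2D; first by case/andP : tT'.
    - by exists (x t); split => //; exact: xb.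
    - exact: le_trans (enorm_dsubmx_le _) (xb _ tT').
    - by rewrite -eE.
  have tin : t \in `]t0, T[ by rewrite in_itv.
  have tnear : nbhs t `[t0, T]%classic.
    by apply: filterS (near_in_itvoo tin); exact: subset_itv_oo_cc.
  have xd : is_derive_within `[t0, T] (fun t => usubmx (x t)) t (usubmx (F t (x t))).
    by apply: is_derive_within_usubmx; apply: xs; rewrite /= in_itv.
  have ud : is_derive_within `[t0, T] (fun t => usubmx (x t)) t (usubmx (F t (u t))).
    apply: (@is_derive_within_eq _ _ _ (fun t => usubmx (u t))).
    - by move=> s; rewrite inE/= in_itv/= => sT; rewrite yE.
    - by rewrite /= in_itv.
    - by apply: is_derive_within_usubmx; apply: us; rewrite /= in_itv.
  (* The common output has one derivative at an interior time; equating its two expressions cancels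
     [f1], and [a != 0] leaves the kernel condition. *)
  have Be : B t (usubmx (x t)) *m e t = 0.
    have [_ dxE] := is_derive_within_interior tnear xd.
    have [_ duE] := is_derive_within_interior tnear ud.
    move: dxE; rewrite duE /F /triangular_system !col_mxKu -yE// => /addrI/eqP.
    rewrite -subr_eq0 -scalerBr scaler_eq0 (negPf (a0 _ tT'))/= -mulmxBr.
    by move=> /eqP Be; rewrite eE -opprB mulmxN Be oppr0.
  exists (D t q (usubmx (x t))); last exact: diss.
  by rewrite linearB/= /F /triangular_system !col_mxKd -yE// f2E eE.
have et0 : enorm (e t0) ^+ 2 <= 4 * r ^+ 2.
  apply: (@le_trans _ _ (enorm (x t0 - u t0) ^+ 2)).
    by rewrite lerXn2r ?nnegrE ?enorm_ge0// enorm_dsubmx_le.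
  apply: (le_trans (sqr_enormB_le _ _)).
  have r0 : 0 <= r := le_trans (enorm_ge0 _) xr.
  have : enorm (x t0) ^+ 2 <= r ^+ 2 by rewrite lerXn2r ?nnegrE ?enorm_ge0.
  have : enorm (u t0) ^+ 2 <= r ^+ 2 by rewrite lerXn2r ?nnegrE ?enorm_ge0.
  lra.
have Cet0 : (1 + L ^+ 2) / 2 * enorm (e t0) ^+ 2 <= (1 + L ^+ 2) / 2 * (4 * r ^+ 2).
  by rewrite ler_wpM2l.
have xi_large' : (1 + L ^+ 2) / 2 * enorm (e t0) ^+ 2 * expR (2 * eps) < xi ^+ 2.
  by apply: le_lt_trans xi_large; rewrite ler_wpM2r ?expR_ge0.
have := enorm_le_decay t0T L1 xi0 Pd Psym cd P1 PL int_d ed diss_e xi_large'.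
move=> eT.
apply: (@le_trans _ _ (enorm (e T) ^+ 2)); last first.
  by apply: (le_trans eT); rewrite ler_wpM2r ?expR_ge0.
(* The first block of [x T - u T] vanishes, so the sup norm only sees [e T]. *)
rewrite lerXn2r ?nnegrE ?enorm_ge0//.
apply: (le_trans _ (norm_le_enorm (e T))).
apply: mx_norm_le => // i j; rewrite -(splitK i); case: (fintype.split i) => k /=.
  have : usubmx (x T - u T) k j = 0.
    by rewrite linearB/= yE ?t0T ?lexx// subrr mxE.
  by rewrite mxE => ->; rewrite normr0.
apply: le_trans (mx_norm_entry _ k j).
by rewrite /e [dsubmx _ k j]mxE.
Qed.

End Detectability.

(** * Causal choice of an initial state consistent with the output *)

Section Consistent.
Context {R : realType} {n1 n2 : nat}.
Variables (x : R -> R -> 'cV[R]_(n1 + n2) -> 'cV[R]_(n1 + n2))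
  (M : set 'cV[R]_(n1 + n2)) (t0 : R).

Definition consistent (y : R -> 'cV[R]_n1) (s : R) : set 'cV[R]_(n1 + n2) :=
  [set u | M u /\ forall t, t0 <= t <= s -> y t = usubmx (x t t0 u)].

(* Near-minimality of the norm bounds the estimate in terms of the unknown
   initial state; it is not known to be attained. *)
Definition near_minimal (C : set 'cV[R]_(n1 + n2)) : set 'cV[R]_(n1 + n2) :=
  [set u | C u /\ forall v, C v -> enorm u <= enorm v + 1].

(** The default 0 is reached only when no near-minimal state exists; [estimateP] excludes this as
    soon as some state is consistent. *)
Definition estimate y s := xget 0 (near_minimal (consistent y s)).

(** A consistent [x0] makes the set of norms nonempty, and 0 bounds it below; so some consistent
    state has norm within 1 of the infimum. *)
Lemma estimateP y s x0 : consistent y s x0 ->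
  consistent y s (estimate y s) /\ enorm (estimate y s) <= enorm x0 + 1.
Proof.
move=> Cx0; pose S := [set enorm v | v in consistent y s].
have iS : has_inf S.
  by split; [exists (enorm x0), x0 | exists 0 => _ [v _ <-]; exact: enorm_ge0].
have [_ [u Cu <-] uS] := inf_adherent ltr01 iS.
have : near_minimal (consistent y s) u.
  split => // v Cv; apply: (le_trans (ltW uS)); rewrite lerD2r.
  by apply: ge_inf; [exact: iS.2 | exists v].
by move=> /(xgetI 0) [Ce eS]; split => //; exact: eS.
Qed.

(** Outputs that agree up to [s] have the same consistent set, and [xget] chooses as a function of
    the set alone. *)
Lemma estimate_causal y y' s : (forall t, t0 <= t <= s -> y t = y' t) ->
  estimate y s = estimate y' s.
Proof.
move=> yy'; rewrite /estimate; congr (xget _ (near_minimal _)).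
by apply/seteqP; split=> u [Mu yu]; split => // t ts; rewrite -yu// yy'.
Qed.

End Consistent.

(** * Construction of the observer and convergence of its error *)

Theorem corollary5p2 (R : realType) (n1 n2 : nat)
    (f1 : R -> 'cV[R]_n1 -> 'cV[R]_n1)
    (f2 : R -> 'cV[R]_n1 -> 'cV[R]_n2 -> 'cV[R]_n2)
    (a : R -> 'cV[R]_n1 -> R) (B : R -> 'cV[R]_n1 -> 'M[R]_(n1, n2))
    (M : set 'cV[R]_(n1 + n2))
    (x : R -> R -> 'cV[R]_(n1 + n2) -> 'cV[R]_(n1 + n2))
    (beta : R -> R -> R -> R)
    (l : nat) (D : R -> 'cV[R]_l -> 'cV[R]_n1 -> 'M[R]_n2)
    (Q : R -> R -> R -> R -> set 'cV[R]_l) :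
  (0 < n1)%N -> (0 < n2)%N -> (0 < l)%N ->
  C0_halfspace f1 -> loc_lipschitz f1 ->
  C0_halfspace (fun t (p : 'cV[R]_n1 * 'cV[R]_n2) => f2 t p.1 p.2) ->
  loc_lipschitz (fun t (p : 'cV[R]_n1 * 'cV[R]_n2) => f2 t p.1 p.2) ->
  C1_halfspace a -> C1_halfspace B ->
  closed M -> M 0 ->
  class_NNN beta ->
  forward_complete_with (triangular_system f1 f2 a B) M x beta ->
  (* (1), with Q r t0 xi t standing for Q_{r, t0, xi}(t) *)
  C0_halfspace (fun t (p : 'cV[R]_l * 'cV[R]_n1) => D t p.1 p.2) ->
  (forall r t0 xi : R, 0 < r -> 0 <= t0 -> 0 < xi ->
     compactness_property t0 (Q r t0 xi) /\
     forall (t : R) (y : 'cV[R]_n1) (x2 z2 : 'cV[R]_n2), t0 <= t ->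
       (exists v : 'cV[R]_(n1 + n2),
          enorm v <= beta t t0 r /\ y = usubmx v) ->
       enorm x2 <= beta t t0 r -> enorm (x2 - z2) <= xi ->
       exists2 q, Q r t0 xi t q & f2 t y x2 - f2 t y z2 = D t q y *m (x2 - z2)) ->
  (* (2) *)
  (exists2 L : R, 1 < L &
   forall r : R, 0 < r -> exists2 eps : R, 0 < eps &
   forall t0 tb xi : R, 0 <= t0 -> t0 <= tb -> 0 < xi ->
   exists (P dP : (R -> 'cV[R]_n1) -> R -> 'M[R]_n2)
          (d : (R -> 'cV[R]_n1) -> R -> R),
     let Y := outputs usubmx x t0 M in
     let yx (x0 : 'cV[R]_(n1 + n2)) t := usubmx (x t t0 x0) in
     let int_d y (t : R) := (\int[lebesgue_measure]_(s in `[tb, t]) d y s)%R in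
     [/\ forall y, Y y ->
           [/\ C1_within `[tb, +oo[ (P y) (dP y),
               forall t, tb <= t -> (P y t)^T = P y t,
               {within `[tb, +oo[, continuous (d y)},
               (forall t, tb <= t -> mxle 1%:M (P y t)) /\
                 opnorm (P y tb) <= L &
               (forall t, tb <= t -> - eps < int_d y t) /\
                 int_d y @ +oo --> +oo],
         forall y, outputs usubmx x t0 [set x0 | M x0 /\ enorm x0 <= r] y ->
           forall (t : R) e q, tb <= t -> B t (y t) *m e = 0 -> Q r t0 xi t q ->
             qform (P y t *m D t q (y t)) e + 2^-1 * qform (dP y t) e
               <= - d y t * qform (P y t) e,
         {within [set p : R * 'cV[R]_(n1 + n2) | tb <= p.1 /\ M p.2],
            continuous (fun p => P (yx p.2) p.1)} /\
         {within [set p : R * 'cV[R]_(n1 + n2) | tb <= p.1 /\ M p.2],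
            continuous (fun p => d (yx p.2) p.1)} &
         causal t0 Y (fun=> `[tb, +oo[%classic) P /\
         causal t0 Y (fun=> `[tb, +oo[%classic) d]) ->
  (* (3) *)
  (forall (t0 : R) x0 (t : R), 0 <= t0 -> M x0 -> t0 <= t ->
     a t (usubmx (x t t0 x0)) != 0) ->
  SSODP usubmx x M.

Proof.
move=> _ _ _ cf1 _ cf2 _ [ca _] [cB _] _ _ [_ betaN] fc _ Q1 [L L1 Q2] a_neq0.
move=> t0 t00.
pose F := triangular_system f1 f2 a B.
have cF : C0_halfspace F by exact: triangular_system_C0.
have beta_le t r t' r' : 0 <= t -> 0 <= r -> t <= t' -> r <= r' ->
    beta t t0 r <= beta t' t0 r'.
  move=> t_ge0 r_ge0 tt' rr'.
  have t'0 := le_trans t_ge0 tt'; have r'0 := le_trans r_ge0 rr'.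
  have [[_ _ bt] _ _] := betaN _ _ t00 r_ge0.
  have [_ _ [_ _ br]] := betaN _ _ t'0 t00.
  by apply: (@le_trans _ _ (beta t' t0 r)); [apply: bt|apply: br];
    rewrite // in_itv/= ?t_ge0 ?t'0 ?r_ge0 ?r'0.
(* One integer [N] bounds both the time and the initial norm, so a single sequence [K], chosen
   before the initial state is known, serves every initial state once [N] is large. *)
have /choice[K K_bound] : forall N : nat, exists k : R, 0 <= k /\ forall s v,
    0 <= s <= N%:R -> enorm v <= beta N%:R t0 N%:R -> `|F s v| <= k.
  move=> N.
  have [k k0 Fk] := C0_halfspace_bounded (Num.max N%:R (beta N%:R t0 N%:R)) cF.
  exists k; split => // s v /andP[s0 sN] vN; apply: Fk.
    by rewrite s0 le_max sN.
  by rewrite le_max (le_trans (norm_le_enorm _) vN) orbT.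
have K0 N : 0 <= K N by have [] := K_bound N.
have [tau [tau0 tau1 tau_lt tauy tau_fine]] := exists_fine_mesh t00 K0.
have tau_homo : {homo tau : m n / (m <= n)%N >-> m <= n}.
  apply: homo_leq => [//|m n p|[|m]]; first exact: le_trans.
    by rewrite tau0 tau1.
  exact/ltW/tau_lt.
have tau_ge m : t0 <= tau m by rewrite -tau0 tau_homo.
have J_lt m : (0 < m)%N -> tau m.-1 < tau m.+1.
  by move=> m0; rewrite (le_lt_trans (tau_homo _ _ (leq_pred m)))// tau_lt.
pose u (y : R -> 'cV[R]_n1) m := estimate x M t0 y (tau m.-1).
pose v y m := x (tau m.-1) t0 (u y m).
(* The rate makes [expR (- lam * delta) * |v|] at most [delta], the length of
   [tau m.-1, tau m]. *)
pose lam y m := `|v y m| / (tau m - tau m.-1) ^+ 2.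
pose theta y m t := expR (- (lam y m * (t - tau m.-1))).
pose dtheta y m t := - lam y m * theta y m t.
(* [G] is the solution that starts at 0: the exponential equals 1 at [tau m.-1], where [v y m] is
   the value of the trajectory. *)
pose G y m t := x t t0 (u y m) - theta y m t *: v y m.
pose g (y : R -> 'cV[R]_n1) m t (_ : 'cV[R]_(n1 + n2)) (_ : 'cV[R]_n1) :=
  F t (x t t0 (u y m)) - dtheta y m t *: v y m.
exists (fun=> tau), g, (fun=> [set 0]) => Y J ode; split.
  move=> m m0 y y' t _ _; rewrite /J/= in_itv/= => /andP[tm _] _ yy'.
  (* On [J y m] one has [tau m.-1 <= t], while [u y m] looks at [y] only up to [tau m.-1]. *)
  have uE : u y m = u y' m.
    apply: estimate_causal => s /andP[s0 sm]; apply: yy'.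
    by rewrite s0 (le_trans sm).
  by rewrite /g /dtheta /theta /lam /v uE.
move=> y Yy.
have JE m t : J y m t = (tau m.-1 <= t <= tau m.+1) by rewrite /J/= in_itv.
have theta_a m : theta y m (tau m.-1) = 1.
  by rewrite /theta subrr mulr0 oppr0 expR0.
have G_a m : G y m (tau m.-1) = 0 by rewrite /G theta_a scale1r subrr.
have J_ge m : J y m `<=` `[t0, +oo[.
  by move=> t; rewrite JE /= in_itv/= andbT => /andP[+ _]; exact: le_trans.
have y_consistent x0 m : M x0 -> (forall t, t0 <= t -> y t = usubmx (x t t0 x0)) ->
    consistent x M t0 y (tau m) x0.
  by move=> Mx0 yx0; split => // t /andP[? _]; exact: yx0.
have uP m : consistent x M t0 y (tau m.-1) (u y m).
  have [[x0 Mx0 yx0] _] := Yy.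
  exact: (estimateP (y_consistent x0 m.-1 Mx0 yx0)).1.
have u_sol m : is_solution F `[t0, +oo[ (fun t => x t t0 (u y m)).
  by have [_ + _] := fc t0 _ t00 (uP m).1.
have theta_d m t : is_derive t (1 : R) (theta y m) (dtheta y m t).
  rewrite /dtheta mulrC; apply: (@is_derive1_comp _ expR).
  have -> : (fun t => - (lam y m * (t - tau m.-1))) =
      - (lam y m *: (id - cst (tau m.-1))) by apply/funext.
  by apply: is_derive_eq; rewrite subr0 /GRing.scale/= mulr1.
have G_sol m : is_solution (ode y m) (J y m) (G y m).
  move=> t Jt; apply: is_derive_withinB; last exact: is_derive_within_scalel.
  apply: (is_derive_withinW (@J_ge m)); apply: u_sol; exact: J_ge Jt.
(* Since [g] ignores the state, the difference of two solutions has zero derivative. *)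
have sol_unique m b z : (0 < m)%N -> tau m.-1 <= b -> `[tau m.-1, b] `<=` J y m ->
    is_solution (ode y m) `[tau m.-1, b] z -> z (tau m.-1) = 0 -> z b = G y m b.
  move=> m0 ab abJ zs za.
  have : `|(z \- G y m) b - (z \- G y m) (tau m.-1)| <= 0 * (b - tau m.-1).
    apply: (@mean_value_le _ _ _ _ (fun=> 0)) => // s sab.
    - have sab' : `[tau m.-1, b]%classic s by rewrite /= in_itv.
      rewrite -(subrr (ode y m s (z s))); apply: is_derive_withinB; first exact: zs.
      by apply: (is_derive_withinW abJ); apply: G_sol; exact: abJ.
    - by rewrite normr0.
  by rewrite mul0r normr_le0 /= za G_a !subr0 subr_eq0 => /eqP.
split => //.
- move=> m m0; apply/subspace_continuousP => -[[t z] w] /= Jt.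
  apply: (cvg_comp (fun p : R * 'cV[R]_(n1 + n2) * 'cV[R]_n1 => p.1.1)
    (fun t => F t (x t t0 (u y m)) - dtheta y m t *: v y m)
    (G := within (J y m) (nbhs t))).
    move=> U JU.
    have fst2 : p.1.1 @[p --> nbhs (t, z, w)] --> t.
      exact: (cvg_comp _ _ cvg_fst cvg_fst).
    exact: (fst2 _ JU).
  have FJ : Filter (within (J y m) (nbhs t)) by exact: within_filter.
  have t_ge0 : 0 <= t.
    by move: (J_ge _ _ Jt); rewrite /= in_itv/= andbT; exact: le_trans.
  apply: cvgB.
    apply: C0_halfspace_cvg => //.
    - rewrite near_withinE; near=> s => Js.
      by move: (J_ge _ _ Js); rewrite /= in_itv/= andbT; exact: le_trans.
    - exact: cvg_within.
    - exact: is_derive_within_continuous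
        (is_derive_withinW (@J_ge m) (u_sol m _ (J_ge _ _ Jt))).
  apply: cvgZ; last exact: cvg_cst.
  apply: cvgM; first exact: cvg_cst.
  exact: (is_derive_within_continuous
    (@derive_is_derive_within _ (J y m) _ _ _ (theta_d m t))).
- by exists 0.
- move=> m A z m0 iA AJ Aa zs /= za.
  exists (G y m); first exact: G_sol.
  move=> t; rewrite inE => At.
  have ab : tau m.-1 <= t by move: (AJ _ At); rewrite JE => /andP[].
  have sA : `[tau m.-1, t] `<=` A.
    by move=> s; rewrite /= in_itv/= => st; exact: (iA _ _ Aa At).
  apply/esym/sol_unique => //; first exact: subset_trans AJ.
  by move=> s st; apply: (is_derive_withinW sA); apply: zs; exact: sA.
move=> z Z x0 zP ZE Mx0 yx0.
(* [r] bounds the true initial norm and, by near-minimality, the norms of all [u y m]. *)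
pose r := enorm x0 + 1.
have r0 : 0 < r by rewrite ltr_wpDl// enorm_ge0.
have x0r : enorm x0 <= r by rewrite lerDl.
have [eps eps0 Q2r] := Q2 r r0.
pose C := (1 + L ^+ 2) / 2 * (4 * r ^+ 2).
have C0 : 0 <= C.
  by apply: mulr_ge0; [rewrite divr_ge0 ?addr_ge0 ?sqr_ge0|rewrite mulr_ge0 ?sqr_ge0].
(* [eps] is fixed before [xi], so [xi] may be built from it; the summand 1 gives [xi <= xi ^+ 2] and
   a strict inequality. *)
pose xi := C * expR (2 * eps) + 1.
have xi1 : 1 <= xi by rewrite lerDr mulr_ge0 ?expR_ge0.
have xi0 : 0 < xi by exact: lt_le_trans xi1.
have xi_large : C * expR (2 * eps) < xi ^+ 2.
  apply: (@lt_le_trans _ _ xi); first by rewrite ltrDl.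
  by rewrite expr2 ler_peMl// ltW.
(* With [tb = t0], a single pair [P y], [d y] serves every [m]. *)
have [P [dP [d [PdP diss _ _]]]] := Q2r t0 t0 xi t00 (lexx _) xi0.
have [[Pd _] Psym cd [P1 PL] [int_lb int_y]] := PdP _ Yy.
have Yr : outputs usubmx x t0 [set x0 | M x0 /\ enorm x0 <= r] y.
  by split; [exists x0 | exact: Yy.2].
pose I (T : R) := (\int[lebesgue_measure]_(s in `[t0, T]) d y s)%R.
have u_r m : enorm (u y m) <= r.
  exact: (estimateP (y_consistent x0 m.-1 Mx0 yx0)).2.
have sub_ge T : `[t0, T] `<=` `[t0, +oo[.
  by move=> s; rewrite /= !in_itv/= andbT => /andP[].
have x_bound w t : M w -> enorm w <= r -> t0 <= t ->
    enorm (x t t0 w) <= beta t t0 r.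
  move=> Mw wr t0t; have [_ _ xb] := fc t0 w t00 Mw.
  by apply: (le_trans (xb _ t0t)); rewrite beta_le ?enorm_ge0// (le_trans t00).
have decay m : `|x (tau m.-1) t0 x0 - v y m| ^+ 2 <= C * expR (- (2 * I (tau m.-1))).
  have [Mu yu] := uP m.
  have [x00 xs _] := fc t0 x0 t00 Mx0.
  have [u00 us _] := fc t0 (u y m) t00 Mu.
  have [_ Q1f] := Q1 r t0 xi r0 t00 xi0.
  apply: (@equal_output_decay _ _ _ _ f1 f2 a B D (fun t => x t t0 x0)
    (fun t => x t t0 (u y m)) (Q r t0 xi) (fun t => beta t t0 r)
    (P y) (dP y) (d y) t0 (tau m.-1) r xi eps L) => //.
  - move=> t tT; apply: (is_derive_withinW (@sub_ge _)).
    by apply: xs; exact: sub_ge tT.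
  - move=> t tT; apply: (is_derive_withinW (@sub_ge _)).
    by apply: us; exact: sub_ge tT.
  - by move=> t tT; rewrite -yu// yx0//; case/andP : tT.
  - by rewrite x00.
  - by rewrite u00.
  - by move=> t /andP[t0t _]; exact: x_bound.
  - by move=> t /andP[t0t _]; exact: a_neq0.
  - move=> t tT; apply: (is_derive_withinW (@sub_ge _)); apply: Pd.
    by apply: (@sub_ge (tau m.-1)); rewrite /= in_itv.
  - by move=> t /andP[t0t _]; exact: Psym.
  - exact: continuous_subspaceW cd.
  - by move=> t /andP[t0t _]; exact: P1.
  - by move=> t /andP[t0t _]; exact: int_lb.
  - move=> t e q /andP[t0t _]; rewrite -yx0//; exact: diss.
(* Once [tau m.-1] is at least [r], the integer [n.+3] dominates both [r] and the times up to
   [tau m.+1]; so both speeds are at most [K n.+3] and the mesh bound applies. *)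
have drift m t : (0 < m)%N -> r <= tau m.-1 -> tau m.-1 <= t <= tau m.+1 ->
    `|(x t t0 x0 - x t t0 (u y m)) - (x (tau m.-1) t0 x0 - v y m)| <=
    4 / (Num.truncn (tau m.-1)).+1%:R.
  move=> m0 rm /andP[mt tm].
  have [tauN Ktau] := tau_fine m m0; set n := Num.truncn _ in tauN Ktau *.
  have K_le w s : M w -> enorm w <= r -> tau m.-1 <= s <= t ->
      `|F s (x s t0 w)| <= K n.+3.
    move=> Mw wr /andP[ms st]; have [_ + ] := K_bound n.+3; apply.
      rewrite (le_trans t00) ?(le_trans (tau_ge m.-1))//=.
      exact: le_trans st (le_trans tm tauN).
    have s0 : t0 <= s := le_trans (tau_ge _) ms.
    apply: (le_trans (x_bound _ _ Mw wr s0)).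
    have sN : s <= n.+3%:R := le_trans st (le_trans tm tauN).
    by apply: beta_le (le_trans t00 s0) (ltW r0) sN (le_trans rm (le_trans ms sN)).
  have := @mean_value_le _ _ _ (fun t => x t t0 x0 - x t t0 (u y m))
    (fun s => F s (x s t0 x0) - F s (x s t0 (u y m))) _ _ (2 * K n.+3) mt.
  have Jge : `[tau m.-1, t] `<=` `[t0, +oo[.
    move=> s; rewrite /= !in_itv/= andbT => /andP[+ _]; exact: le_trans.
  have [_ xs _] := fc t0 x0 t00 Mx0.
  have H1 : 0 <= 2 * K n.+3 by rewrite mulr_ge0.
  move=> /(_ H1) H; apply: (le_trans (H _ _)).
  - move=> s st; have st' : `[tau m.-1, t]%classic s by rewrite /= in_itv.
    apply: is_derive_withinB; apply: (is_derive_withinW Jge).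
      by apply: xs; exact: Jge.
    by apply: u_sol; exact: Jge.
  - move=> s st; apply: (le_trans (ler_normB _ _)).
    have := K_le _ _ Mx0 x0r st; have := K_le _ _ (uP m).1 (u_r m) st; lra.
  - have K3 := K0 n.+3.
    have h1 : K n.+3 * (t - tau m.-1) <= (1 + K n.+3) * (tau m.+1 - tau m.-1).
      by apply: ler_pM; rewrite ?subr_ge0 ?lerD2r// lerDr.
    have -> : 4 / n.+1%:R = 2 * (2 / n.+1%:R) :> R by rewrite mulrA -natrM.
    by rewrite -mulrA ler_wpM2l// (le_trans h1).
(* [1 < m] ensures [delta > 0], as [tau 0 = tau 1]. The estimate is [s <= expR s] for
   [s = lam y m * (t - tau m.-1)], which is at least the norm of [v y m] divided by [delta]. *)
have theta_small m t : (1 < m)%N -> tau m <= t ->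
    `|theta y m t *: v y m| <= 2 / (Num.truncn (tau m.-1)).+1%:R.
  move=> m1 mt; have m0 : (0 < m)%N by exact: ltnW.
  pose delta := tau m - tau m.-1.
  have delta0 : 0 < delta.
    by rewrite subr_gt0; case: m m1 {m0 mt} @delta => [//|[//|m]] _ _; exact: tau_lt.
  have [_ /(le_trans _)] := tau_fine m m0; apply.
  apply: (@le_trans _ _ delta); last first.
    apply: (@le_trans _ _ (1 * (tau m.+1 - tau m.-1))).
      by rewrite mul1r lerD2r ltW// tau_lt.
    by rewrite ler_wpM2r ?lerDl// subr_ge0 ltW// J_lt.
  rewrite normrZ (ger0_norm (expR_ge0 _)) mulrC.
  rewrite expRN ler_pdivrMr ?expR_gt0//.
  have le1 : `|v y m| / delta <= lam y m * (t - tau m.-1).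
    have -> : `|v y m| / delta = lam y m * delta.
      by rewrite /lam -/delta; field; rewrite gt_eqF.
    by rewrite ler_wpM2l ?lerD2r// /lam divr_ge0// sqr_ge0.
  rewrite mulrC -ler_pdivrMr//; apply: (le_trans le1).
  by apply: le_trans (expR_ge1Dx _); rewrite lerDr.
apply/cvgr0Pnorm_lt => e e0.
pose e2 := (e / 2) ^+ 2.
have e20 : 0 < e2 by rewrite exprn_gt0// divr_gt0.
(* The first condition brings the error at time [tau m] below [e / 2], the second enables [drift],
   and the third brings the two mesh terms, in all [6 / n.+1%:R], below [e / 2]. *)
have [m0 _ m0P] : \forall m \near \oo,
    [/\ C / e2 <= I (tau m), r <= tau m & 12 / e <= tau m].
  have Itau : I (tau m) @[m --> \oo] --> +oo by exact: (cvg_comp _ _ tauy int_y).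
  near=> m; split; near: m.
  - by move/cvgryPge : Itau; exact.
  - by move/cvgryPge : tauy; exact.
  - by move/cvgryPge : tauy; exact.
near=> t.
(* The shift by 2 makes the index [m] of the interval containing [t] satisfy [m0 <= m.-1] and
   [1 < m]. *)
have m0t : tau m0.+2 <= t by near: t; apply: nbhs_pinfty_ge; exact: num_real.
have exk : exists k, t < tau k.
  by move/cvgryPgt : tauy => /(_ t)[k _ kt]; exists k; apply: kt => /=.
(* By minimality of [k], its predecessor [m] satisfies [tau m <= t < tau m.+1]. *)
have [k tk kmin] := ex_minnP exk.
have m0k : (m0.+2 < k)%N.
  rewrite ltnNge; apply/negP => /tau_homo km.
  by have := le_lt_trans (le_trans km m0t) tk; rewrite ltxx.
have [m km] : exists m, k = m.+1 by case: k m0k {tk kmin} => // m _; exists m.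
rewrite km ltnS in tk m0k kmin *.
have mt : tau m <= t.
  by rewrite leNgt; apply/negP => /kmin; rewrite ltnn.
have m_gt1 : (1 < m)%N by exact: leq_trans m0k.
have m_gt0 : (0 < m)%N by exact: ltnW.
have m1m : (m0 <= m.-1)%N by rewrite -ltnS prednK// ltnW.
have [Im rm em] := m0P _ m1m.
have tJ : tau m.-1 <= t <= tau m.+1.
  by rewrite (le_trans (tau_homo _ _ (leq_pred m)) mt) ltW.
have Zt : Z t = x t t0 (u y m) - theta y m t *: v y m.
  rewrite (ZE m)// ?mt//; have [zs z0] := zP _ m_gt0.
  have sJ : `[tau m.-1, t] `<=` J y m.
    move=> s; rewrite JE /= in_itv/= => /andP[-> st].
    by rewrite (le_trans st)//; case/andP : tJ.
  apply: sol_unique => //; first by case/andP : tJ.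
  by move=> s st; apply: (is_derive_withinW sJ); apply: zs; exact: sJ.
rewrite Zt.
have dec : `|x (tau m.-1) t0 x0 - v y m| < e / 2.
  rewrite -(@ltr_pXn2r _ 2)// ?nnegrE// ?divr_ge0 ?(ltW e0)//.
  apply: (le_lt_trans (decay m)).
  have CI : C / e2 < 1 + 2 * I (tau m.-1).
    have : 0 <= C / e2 by apply: divr_ge0 => //; exact: ltW.
    by move: Im; lra.
  have expI := lt_le_trans CI (expR_ge1Dx _).
  by rewrite expRN ltr_pdivrMr ?expR_gt0// mulrC -ltr_pdivrMr.
have := drift _ _ m_gt0 rm tJ.
have := theta_small _ _ m_gt1 mt.
set n := Num.truncn _ => theta_le drift_le.
have n_le : 6 / n.+1%:R < e / 2.
  rewrite ltr_pdivrMr// -ltr_pdivrMl ?divr_gt0//.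
  apply: (@le_lt_trans _ _ (12 / e)).
    by rewrite le_eqVlt; apply/orP; left; apply/eqP; field; rewrite gt_eqF.
  exact: le_lt_trans em (truncnS_gt _).
(* The error splits into the distance of the two trajectories at [tau m.-1], their drift since then,
   and the exponential remainder. *)
rewrite (_ : _ - _ = (x (tau m.-1) t0 x0 - v y m) +
  ((x t t0 x0 - x t t0 (u y m)) - (x (tau m.-1) t0 x0 - v y m)) +
  theta y m t *: v y m); last first.
  by rewrite [X in _ = X + _]addrC subrK opprB addrA addrAC.
apply: (le_lt_trans (ler_normD _ _)).
apply: (le_lt_trans (lerD (ler_normD _ _) (lexx _))).
have -> : e = e / 2 + e / 2 by rewrite -splitr.
apply: (@lt_le_trans _ _ (e / 2 + 6 / n.+1%:R)); last by rewrite lerD2l ltW.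
have -> : 6 / n.+1%:R = 4 / n.+1%:R + 2 / n.+1%:R :> R by rewrite -mulrDl -natrD.
by rewrite addrA ltr_leD// ltr_leD.
Unshelve. all: by end_near. Qed.
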